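(* Let $L=(D_L,<_L)$ be a linear order definable in $(\mathbb{Z};<,+)$. Then there exist $n\in\mathbb{N}$ and a map $f\colon D_L\to\mathbb{Z}^n$ whose graph is definable in $(\mathbb{Z};<,+)$ such that $f$ is an embedding of $L$ into $\mathbb{Z}^n$ equipped with the lexicographic order, i.e. for all $a,b\in D_L$, $a<_L b$ if and only if $f(a)<_{lex}f(b)$ (and $f$ is injective).
   Context: Definable means first-order definable in the structure $(\mathbb{Z};<,+)$ (with parameters from $\mathbb{Z}$ allowed; this makes no difference since every integer is definable). A linear order $L$ is definable in $(\mathbb{Z};<,+)$ if for some $m\ge 1$ its domain $D_L\subseteq\mathbb{Z}^m$ and its strict comparison relation $<_L\,\subseteq D_L\times D_L\subseteq\mathbb{Z}^{2m}$ are definable sets. The lexicographic order on $\mathbb{Z}^n$ is: $(x_0,\dots,x_{n-1})<_{lex}(y_0,\dots,y_{n-1})$ iff there is $i<n$ with $x_j=y_j$ for all $j<i$ and $x_i<y_i$. *)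

(* Defs.v *)
From mathcomp Require Import all_boot all_order all_algebra.
From mathcomp Require Import classical_sets.

Set Implicit Arguments.
Unset Strict Implicit.
Unset Printing Implicit Defensive.

Import Order.TTheory GRing.Theory Num.Theory.

Local Open Scope classical_set_scope.
Local Open Scope ring_scope.

(* First-order logic in the language {<, +} (with equality). Terms and formulas
   are well scoped: those at index n have their free variables among n. *)

Inductive term (n : nat) : Type :=
| TVar of 'I_n
| TAdd of term n & term n.

(* [FEx] binds variable 0 and shifts the other variables by one. The omitted
   connectives and the universal quantifier are definable, since [holds] below
   takes values in Prop and is read classically. *)
Inductive formula (n : nat) : Type :=
| FEq of term n & term n
| FLt of term n & term n
| FNot of formula n
| FAnd of formula n & formula n
| FEx of formula n.+1.

Fixpoint eval n (e : n.-tuple int) (t : term n) : int :=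
  match t with
  | TVar i => tnth e i
  | TAdd t1 t2 => eval e t1 + eval e t2
  end.

Fixpoint holds n (e : n.-tuple int) (phi : formula n) {struct phi} : Prop :=
  match phi with
  | FEq t1 t2 => eval e t1 = eval e t2
  | FLt t1 t2 => eval e t1 < eval e t2
  | FNot phi1 => ~ holds e phi1
  | FAnd phi1 phi2 => holds e phi1 /\ holds e phi2
  | FEx phi1 => exists z : int, holds (cons_tuple z e) phi1
  end.

(* The last k variables of the defining formula carry the integer parameters. *)
Definition definable m (X : set (m.-tuple int)) : Prop :=
  exists (k : nat) (p : k.-tuple int) (phi : formula (m + k)),
    X = [set x | holds (cat_tuple x p) phi].

(* Subsets of Z^m x Z^n are definable as subsets of Z^(m+n). *)
Definition definable2 m n (X : set (m.-tuple int * n.-tuple int)) : Prop :=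
  definable [set cat_tuple z.1 z.2 | z in X].

Definition graph_on (S T : Type) (D : set S) (f : S -> T) : set (S * T) :=
  [set (x, f x) | x in D].

Definition strict_linear_order (T : Type) (D : set T) (lt : set (T * T)) : Prop :=
  [/\ lt `<=` D `*` D,
      forall a, D a -> ~ lt (a, a),
      forall a b c, D a -> D b -> D c -> lt (a, b) -> lt (b, c) -> lt (a, c)
    & forall a b, D a -> D b -> [\/ lt (a, b), a = b | lt (b, a)]].

Definition definable_linear_order m (D : set (m.-tuple int))
    (lt : set (m.-tuple int * m.-tuple int)) : Prop :=
  [/\ strict_linear_order D lt, definable D & definable2 lt].

(* The strict order of the library's lexicographic tuples, in which the entry
   of index 0 is the most significant. *)
Definition lexlt n (x y : n.-tuple int) : bool :=
  ((x : n.-tuplelexi int) < (y : n.-tuplelexi int))%O.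

Lemma lexltP n (x y : n.-tuple int) :
  lexlt x y <->
  exists i : 'I_n, (forall j : 'I_n, (j < i)%N -> tnth x j = tnth y j)
                   /\ tnth x i < tnth y i.
Proof.
elim: n x y => [|n IHn] x y.
  by rewrite (tuple0 x) (tuple0 y) /lexlt Order.POrderTheory.ltxx; split=> // -[[]].
case/tupleP: x => a x; case/tupleP: y => b y.
have -> : lexlt (cons_tuple a x) (cons_tuple b y)
          = (a <= b) && ((b <= a) ==> lexlt x y) by [].
split.
- case/andP; case: (ltgtP a b) => //= [ltab _ _|<- _ /IHn [i [eqi lti]]].
    by exists ord0; rewrite !tnth0.
  exists (lift ord0 i); rewrite !tnthS; split=> // j.
  by case: (unliftP ord0 j) => [j' ->|-> _]; rewrite ?tnth0 // !tnthS; apply: eqi.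
- case=> i [eqi]; case: (unliftP ord0 i) eqi => [i' ->|->] eqi.
    have:= eqi ord0 isT; rewrite !tnth0 => ->; rewrite lexx !tnthS => lti.
    apply/IHn; exists i'; split=> // j ltj.
    by have:= eqi (lift ord0 j); rewrite !tnthS; apply.
  by rewrite !tnth0; case: ltgtP.
Qed.

(* Main.v *)
(* To a in D attach the characteristic function of the set of its predecessors, a
   function Z^m -> {0, 1}. These functions form a chain for the pointwise order,
   and they are coded by tuples of integers by eliminating the m arguments one at
   a time. The elimination step takes a definable family h_a : Z -> Z^n, where Z^n
   is ordered lexicographically, to a definable code of a in some Z^n' which is
   strictly increasing for the pointwise order on the h_a. By quantifier
   elimination h_a is piecewise affine on each residue class modulo some M, with a
   number of pieces that does not depend on a. On a half-line in such a class,
   compare two sequences at the first place where they differ: this is the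
   lexicographic comparison of their run-length codes, that is, of the initial
   values followed by the directions and the positions of the bends. Concatenating
   these codes over the finitely many half-lines gives the code of a. *)
Require Import Defs.
From mathcomp Require Import all_boot all_order all_algebra.
From mathcomp Require Import boolp classical_sets.
From mathcomp Require Import zify ring.

Set Implicit Arguments.
Unset Strict Implicit.
Unset Printing Implicit Defensive.

Import Order.TTheory GRing.Theory Num.Theory.

Local Open Scope ring_scope.

(** * Linear forms and quantifier-free Presburger predicates *)

Definition env := nat -> int.

Definition scons (z : int) (e : env) : env :=
  fun i => if i is j.+1 then e j else z.

Definition stail (e : env) : env := fun i => e i.+1.

Notation "z .: e" := (scons z e) (at level 55, right associativity).

Lemma scons_eta (e : env) : e 0%N .: stail e = e.
Proof. by apply/funext => -[]. Qed.

Inductive lin : (env -> int) -> Prop :=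
| lin_cst c : lin (fun=> c)
| lin_var i : lin (fun e => e i)
| lin_add f g of lin f & lin g : lin (fun e => f e + g e)
| lin_scale c f of lin f : lin (fun e => c * f e).

(* Quantifier-free Presburger predicates, represented by their meaning on
   infinite environments rather than by syntax; variable 0 is the innermost. *)
Inductive qf : (env -> Prop) -> Prop :=
| qf_pos f of lin f : qf (fun e => 0 < f e)
| qf_dvd (d : int) f of d != 0 & lin f : qf (fun e => exists q, d * q = f e)
| qf_not P of qf P : qf (fun e => ~ P e)
| qf_and P Q of qf P & qf Q : qf (fun e => P e /\ Q e).

Lemma lin_ext f g : f =1 g -> lin f -> lin g.
Proof. by move/funext->. Qed.

Lemma qf_ext (P Q : env -> Prop) : (forall e, P e <-> Q e) -> qf P -> qf Q.
Proof. by move=> PQ; suff -> : P = Q by []; apply/funext => e; apply/propext. Qed.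

Lemma lin_opp f : lin f -> lin (fun e => - f e).
Proof. by move/(lin_scale (-1)); apply: lin_ext => e; rewrite mulN1r. Qed.

Lemma lin_sub f g : lin f -> lin g -> lin (fun e => f e - g e).
Proof. by move=> lf /lin_opp; apply: lin_add. Qed.

Lemma lin_comp f (s : env -> env) :
  (forall i, lin (fun e => s e i)) -> lin f -> lin (fun e => f (s e)).
Proof.
move=> ls; elim=> [c|i|g h _ lg _ lh|c g _ lg] //; first exact: lin_cst.
- exact: lin_add.
- exact: lin_scale.
Qed.

Lemma qf_lin_comp P (s : env -> env) :
  (forall i, lin (fun e => s e i)) -> qf P -> qf (fun e => P (s e)).
Proof.
move=> ls; elim=> [f lf|d f d0 lf|Q _ IH|Q Q' _ IH _ IH'].
- exact/qf_pos/lin_comp.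
- exact/qf_dvd/lin_comp.
- exact: qf_not.
- exact: qf_and.
Qed.

(** De Morgan, read classically, since [qf] is generated by negation and conjunction only. *)
Lemma qf_or P Q : qf P -> qf Q -> qf (fun e => P e \/ Q e).
Proof.
move=> qP qQ; apply: (@qf_ext (fun e => ~ (~ P e /\ ~ Q e))).
  by move=> e; split=> [/not_andP[] /contrapT|[]]; tauto.
by apply/qf_not/qf_and; apply: qf_not.
Qed.

Lemma qf_cst (p : Prop) : qf (fun=> p).
Proof.
have [hp|hp] := pselect p.
  by apply: (@qf_ext (fun=> 0 < 1 :> int)) => //; apply/qf_pos/lin_cst.
by apply: (@qf_ext (fun=> 0 < 0 :> int)) => //; apply/qf_pos/lin_cst.
Qed.

Lemma qf_exists_in (I : eqType) (s : seq I) (P : I -> env -> Prop) :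
  (forall i, i \in s -> qf (P i)) -> qf (fun e => exists2 i, i \in s & P i e).
Proof.
elim: s => [|i s IH] qP.
  by apply: qf_ext (qf_cst False) => e; split=> // -[].
apply: (@qf_ext (fun e => P i e \/ exists2 j, j \in s & P j e)).
  move=> e; split=> [[Pi|[j js Pj]]|[j]].
  - by exists i => //; rewrite mem_head.
  - by exists j => //; rewrite in_cons js orbT.
  - by rewrite in_cons => /orP[/eqP->|js Pj]; [left|right; exists j].
apply: qf_or; first by apply: qP; rewrite mem_head.
by apply: IH => j js; apply: qP; rewrite in_cons js orbT.
Qed.

(** * Linear branches and uniformly finite sets *)

Lemma lin_decomp f :
  lin f -> exists (c : int) g, lin g /\ forall z e, f (z .: e) = c * z + g e.
Proof.
elim=> [c|[|i]|g h _ [c [g' [lg Eg]]] _ [d [h' [lh Eh]]]|c g _ [d [g' [lg Eg]]]].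
- by exists 0, (fun=> c); split=> [|z e]; [exact: lin_cst|rewrite mul0r add0r].
- by exists 1, (fun=> 0); split=> [|z e]; [exact: lin_cst|rewrite mul1r addr0].
- by exists 0, (fun e => e i); split=> [|z e]; [exact: lin_var|rewrite mul0r add0r].
- exists (c + d), (fun e => g' e + h' e); split=> [|z e]; first exact: lin_add.
  by rewrite Eg Eh; ring.
- exists (c * d), (fun e => c * g' e); split=> [|z e]; first exact: lin_scale.
  by rewrite Eg; ring.
Qed.

(* A pair (c, g) stands for the partial function e |-> g(e) / c. *)
Definition branches := seq (int * (env -> int)).

Definition lin_branches (B : branches) : Prop :=
  forall b, b \in B -> b.1 != 0 /\ lin b.2.

Definition on_branch (B : branches) (z : int) (e : env) : Prop :=
  exists2 b, b \in B & b.1 * z = b.2 e.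

Lemma lin_branches_cat B C :
  lin_branches B -> lin_branches C -> lin_branches (B ++ C).
Proof. by move=> hB hC b; rewrite mem_cat => /orP[/hB|/hC]. Qed.

Lemma on_branch_cat B C z e :
  on_branch B z e \/ on_branch C z e -> on_branch (B ++ C) z e.
Proof. by case=> -[b bB Eb]; exists b => //; rewrite mem_cat bB ?orbT. Qed.

(** Uniform finiteness: over each [e] there are at most [size B] values of [z], a bound independent
    of [e], and each is a quotient of a linear form by a nonzero constant. *)
Definition thin (T : int -> env -> Prop) : Prop :=
  exists B, lin_branches B /\ forall z e, T z e -> on_branch B z e.

Lemma thin_sub (T T' : int -> env -> Prop) :
  (forall z e, T z e -> T' z e) -> thin T' -> thin T.
Proof. by move=> sTT' [B [lB hB]]; exists B; split=> // z e /sTT'/hB. Qed.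

Lemma thin_or T T' : thin T -> thin T' -> thin (fun z e => T z e \/ T' z e).
Proof.
move=> [B [lB hB]] [C [lC hC]]; exists (B ++ C).
split=> [|z e [/hB|/hC]]; first exact: lin_branches_cat.
  by move=> ?; apply: on_branch_cat; left.
by move=> ?; apply: on_branch_cat; right.
Qed.

Lemma thin_exists_in (I : eqType) (s : seq I) (T : I -> int -> env -> Prop) :
  (forall i, i \in s -> thin (T i)) ->
  thin (fun z e => exists2 i, i \in s & T i z e).
Proof.
elim: s => [|i s IH] tT; first by exists [::]; split=> // z e [].
have h1 : thin (T i) by apply: tT; rewrite mem_head.
have h2 : thin (fun z e => exists2 j, j \in s & T j z e).
  by apply: IH => j js; apply: tT; rewrite in_cons js orbT.
apply: thin_sub (thin_or h1 h2) => z e [j]; rewrite in_cons => /orP[/eqP->|].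
  by left.
by right; exists j.
Qed.

Lemma thin_shift T M : thin T -> thin (fun z e => T (z + M) e).
Proof.
move=> [B [lB hB]]; exists [seq (b.1, fun e => b.2 e - b.1 * M) | b <- B].
split=> [b /mapP[b' /lB[c0 lb] ->]|z e /hB[b bB Eb]].
  by split=> //; apply/lin_sub/lin_cst.
exists (b.1, fun e => b.2 e - b.1 * M); first exact: (map_f (fun b => _) bB).
by rewrite /= -Eb; ring.
Qed.

(** Sending [y] to the first branch through it is injective, because a nonzero leading coefficient
    leaves a branch only one value over [e]. *)
Lemma on_branch_size B e s : lin_branches B -> uniq s ->
  (forall y, y \in s -> on_branch B y e) -> (size s <= size B)%N.
Proof.
move=> lB us hs; pose p y (b : int * (env -> int)) := b.1 * y == b.2 e.
have hp y : y \in s -> has (p y) B.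
  by move=> /hs[b bB Eb]; apply/hasP; exists b => //; apply/eqP.
rewrite -(size_map (fun y => find (p y) B)) -[leqRHS](size_iota 0).
apply: uniq_leq_size => [|n /mapP[y ys ->]]; last first.
  by rewrite mem_iota -has_find hp.
rewrite map_inj_in_uniq // => y y' ys ys' Ef; pose b0 : int * (env -> int) := (0, fun=> 0).
have := nth_find b0 (hp _ ys); have := nth_find b0 (hp _ ys').
have [] := lB _ (mem_nth b0 (etrans (esym (has_find (p y) B)) (hp _ ys))).
by rewrite -Ef /p => c0 _ /eqP <- /eqP /(mulfI c0).
Qed.

(** * Periods of quantifier-free predicates *)

(** Asking for all positive multiples makes finitely many such conditions compatible: the product of
    their periods serves them all. *)
Definition for_multiples (R : int -> Prop) : Prop :=
  exists2 M0, 0 < M0 & forall q, 0 < q -> R (q * M0).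

Lemma for_multiples_sub (R S : int -> Prop) :
  (forall M, 0 < M -> R M -> S M) -> for_multiples R -> for_multiples S.
Proof.
move=> sRS [M M0 hM]; exists M => // q q0; apply: sRS (hM q q0).
exact: mulr_gt0.
Qed.

Lemma for_multiples_and R S : for_multiples R -> for_multiples S ->
  for_multiples (fun M => R M /\ S M).
Proof.
move=> [M M0 hM] [N N0 hN]; exists (M * N) => [|q q0]; first exact: mulr_gt0.
split; last by rewrite mulrA; apply/hN/mulr_gt0.
by rewrite mulrCA mulrC; apply/hM/mulr_gt0.
Qed.

Lemma for_multiples_all (I : eqType) (s : seq I) (R : I -> int -> Prop) :
  (forall i, i \in s -> for_multiples (R i)) ->
  for_multiples (fun M => forall i, i \in s -> R i M).
Proof.
elim: s => [|i s IH] hR; first by exists 1.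
have h1 : for_multiples (R i) by apply: hR; rewrite mem_head.
have h2 : for_multiples (fun M => forall i, i \in s -> R i M).
  by apply: IH => j js; apply: hR; rewrite in_cons js orbT.
apply: for_multiples_sub (for_multiples_and h1 h2) => M _ [RM sM] j.
by rewrite in_cons => /orP[/eqP->|/sM].
Qed.

Definition crossing_period (P : env -> Prop) (M : int) : Prop :=
  thin (fun z e => ~ (P (z .: e) <-> P ((z + M) .: e))).

(* Between z and z + M an inequality c z + g(e) > 0 can only flip if
   |c z + g(e)| <= |c| M, which leaves finitely many values of c z + g(e). *)
Lemma qf_crossings P : qf P -> for_multiples (crossing_period P).
Proof.
elim=> [f lf|d f d0 lf|Q _ IH|Q Q' _ IH _ IH'].
- exists 1 => // q q0; rewrite mulr1.
  have [c [g [lg Ef]]] := lin_decomp lf.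
  have [c_0|c0] := eqVneq c 0.
    by exists [::]; split=> // z e []; rewrite !Ef c_0 !mul0r.
  pose n := `|(c * q)%R|%N.
  exists [seq (c, fun e => (j%:Z - n%:Z) - g e) | j <- iota 0 (n + n).+1].
  split=> [b /mapP[j _ ->]|z e].
    by split=> //; apply: lin_sub => //; apply: lin_cst.
  rewrite !Ef mulrDr => H.
  have Hn : (`|(c * z + g e)%R| <= n)%N by rewrite /n; lia.
  pose k := `|(c * z + g e + n%:Z)%R|%N.
  exists (c, fun e => (k%:Z - n%:Z) - g e); last by rewrite /k /=; lia.
  by apply/mapP; exists k => //; rewrite mem_iota /k; lia.
(* Shifts by multiples of [d] preserve divisibility by [d], so there are no crossings and the list
   of branches is empty. *)
- exists `|d|; first by rewrite normr_gt0.
  move=> q q0; exists [::]; split=> // z e []; have [c [g [lg Ef]]] := lin_decomp lf.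
  rewrite !Ef.
  have -> : q * `|d| = d * (q * Num.sg d) by rewrite normrEsg; ring.
  split=> [[r Er]|[r Er]].
    by exists (r + c * (q * Num.sg d)); rewrite mulrDr Er; ring.
  by exists (r - c * (q * Num.sg d)); rewrite mulrBr Er; ring.
- apply: for_multiples_sub IH => M _; apply: thin_sub => z e; tauto.
- apply: for_multiples_sub (for_multiples_and IH IH') => M _ [tQ tQ'].
  apply: thin_sub (thin_or tQ tQ') => z e H.
  have [?|?] := pselect (Q (z .: e) <-> Q ((z + M) .: e)); last by left.
  by right => ?; apply: H; tauto.
Qed.

(** * Quantifier elimination *)

(** On a branch the witness is unique, so the quantifier commutes with negation and conjunction. In
    the atoms the denominator is cleared: by [c * c], which is positive, for inequalities, and by
    [c] for divisibilities. *)
Lemma qf_on_branch P c g : qf P -> c != 0 -> lin g ->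
  qf (fun e => exists z, c * z = g e /\ P (z .: e)).
Proof.
move=> qP c0 lg; have qg : qf (fun e => exists z, c * z = g e) by apply: qf_dvd.
have inj z z' e : c * z = g e -> c * z' = g e -> z = z'.
  by move=> <- /(mulfI c0).
elim: qP => [f lf|d f d0 lf|Q _ IH|Q Q' _ IH _ IH'].
- have [a [h [lh Ef]]] := lin_decomp lf.
  apply: qf_ext (qf_and qg (qf_pos (lin_add (lin_scale (c * a) lg)
                                            (lin_scale (c * c) lh)))) => e.
  have E z : c * z = g e -> c * a * g e + c * c * h e = c * c * f (z .: e).
    by move=> <-; rewrite Ef; ring.
  have cc : 0 < c * c by rewrite -expr2 exprn_even_gt0.
  split=> [[[z Ez]]|[z [Ez]]]; rewrite (E z Ez) pmulr_rgt0 // => fz.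
    by exists z.
  by split=> //; exists z.
- have [a [h [lh Ef]]] := lin_decomp lf.
  have cd0 : c * d != 0 by rewrite mulf_neq0.
  apply: qf_ext (qf_and qg (qf_dvd cd0 (lin_add (lin_scale a lg)
                                            (lin_scale c lh)))) => e.
  have E z : c * z = g e -> a * g e + c * h e = c * f (z .: e).
    by move=> <-; rewrite Ef; ring.
  split=> [[[z Ez] [q]]|[z [Ez [q Eq]]]].
    by rewrite (E z Ez) -mulrA => /(mulfI c0) Eq; exists z; split=> //; exists q.
  by split; [exists z|exists q; rewrite (E z Ez) -mulrA Eq].
- apply: qf_ext (qf_and qg (qf_not IH)) => e; split=> [[[z Ez] nQ]|[z [Ez nQ]]].
    by exists z; split=> // Qz; apply: nQ; exists z.
  by split; [exists z|case=> z' [Ez']; rewrite (inj z' z e)].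
- apply: qf_ext (qf_and IH IH') => e.
  split=> [[[z [Ez Qz]] [z' [Ez' Qz']]]|[z [Ez [Qz Qz']]]].
    by exists z; do !split=> //; rewrite (inj z z' e).
  by split; exists z.
Qed.

Lemma lin_scons (f : env -> int) i : lin f -> lin (fun e => (f e .: e) i).
Proof. by case: i => [|i] lf //=; apply: lin_var. Qed.

Lemma periodic_residue (Q : int -> Prop) (M : int) :
  (forall z, Q z <-> Q (z + M)) -> forall q z, Q z <-> Q (z + q * M).
Proof.
move=> QM; elim=> [|n IH|n IH] z; first by rewrite mul0r addr0.
  by rewrite intS mulrDl mul1r addrA -IH.
rewrite IH [X in _ <-> X]QM.
by have -> : z + - n%:Z * M = z + - n.+1%:Z * M + M by rewrite intS; ring.
Qed.

(* Either P is invariant under the shift by M, so that residues mod M suffice as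
   witnesses, or some shift flips P and one of its two ends is a witness. *)
Lemma qf_ex P : qf P -> qf (fun e => exists z, P (z .: e)).
Proof.
move=> qP; have [M M0 hM] := qf_crossings qP; have [] := hM 1 ltr01.
rewrite mul1r => B [lB hB].
have qPM : qf (fun e => P ((e 0%N + M) .: stail e)).
  apply: qf_lin_comp (qP) => -[|i] /=; last exact: lin_var.
  by apply: lin_add; [apply: lin_var|apply: lin_cst].
have q1 : qf (fun e => exists2 r, r \in iota 0 `|M|%N & P (r%:Z .: e)).
  apply: qf_exists_in => r _; apply: qf_lin_comp (qP) => i.
  exact/lin_scons/lin_cst.
have q2 : qf (fun e => exists2 b, b \in B &
   ((exists z, b.1 * z = b.2 e /\ P (z .: e)) \/
    (exists z, b.1 * z = b.2 e /\ P ((z + M) .: e)))).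
  apply: qf_exists_in => b /lB[b0 lb]; apply: qf_or; first exact: qf_on_branch.
  exact: (qf_on_branch qPM).
apply: qf_ext (qf_or q1 q2) => e; split.
  by case=> [[r _ Pr]|[b _ [[z [_ Pz]]|[z [_ Pz]]]]];
     [exists r|exists z|exists (z + M)].
case=> z0 Pz0.
have [per|/existsNP[z Hz]] := pselect (forall z, P (z .: e) <-> P ((z + M) .: e)).
  left; exists `|(z0 %% M)%Z|%N.
    by rewrite mem_iota /=; have := ltz_pmod z0 M0; have := modz_ge0 z0 (lt0r_neq0 M0); lia.
  rewrite gez0_abs ?modz_ge0 ?lt0r_neq0 //.
  apply/(periodic_residue per (z0 %/ M)%Z).
  by rewrite addrC -divz_eq.
right; have [b bB Eb] := hB z e Hz; exists b => //.
have [Pz|nPz] := pselect (P (z .: e)); first by left; exists z.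
by right; exists z; split=> //; apply: contrapT => ?; apply: Hz.
Qed.

Lemma qf_eq_lin f g : lin f -> lin g -> qf (fun e => f e = g e).
Proof.
move=> lf lg; apply: (@qf_ext (fun e => ~ 0 < f e - g e /\ ~ 0 < g e - f e)).
  by move=> e; split=> [[]|]; lia.
by apply: qf_and; apply/qf_not/qf_pos/lin_sub.
Qed.

(** * Definable functions and substitution *)

Definition dfun (g : env -> int) : Prop := qf (fun e => e 0%N = g (stail e)).

Lemma dfun_ext f g : f =1 g -> dfun f -> dfun g.
Proof. by move/funext->. Qed.

Lemma dfun_lin f : lin f -> dfun f.
Proof.
move=> lf; apply: qf_eq_lin; first exact: lin_var.
by apply: lin_comp lf => i; apply: lin_var.
Qed.

(** Quantify over the value of [g], constrained by its graph, and eliminate the quantifier. *)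
Lemma qf_scons P g : qf P -> dfun g -> qf (fun e => P (g e .: e)).
Proof.
move=> qP dg; apply: qf_ext (qf_ex (qf_and dg qP)) => e.
by split=> [[z [/= -> ?]]|?]; [|exists (g e)].
Qed.

Lemma dfun_lin_comp g (s : env -> env) :
  (forall i, lin (fun e => s e i)) -> dfun g -> dfun (fun e => g (s e)).
Proof.
move=> ls dg.
apply: (@qf_lin_comp _ (fun e => e 0%N .: s (stail e)) _ dg) => -[|i] /=.
  exact: lin_var.
by apply: (lin_comp (s := stail)) (ls i) => j; apply: lin_var.
Qed.

Lemma dfun_scons f g : dfun f -> dfun g -> dfun (fun e => f (g e .: e)).
Proof.
move=> df dg.
(* The graph of [f] with the argument in variable 0 and the value in variable 1, so that [qf_scons]
   can substitute [g] for the argument. *)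
pose P (e : env) := e 1%N = f (e 0%N .: stail (stail e)).
have qP : qf P.
  apply: (@qf_lin_comp _ (fun e => e 1%N .: (e 0%N .: stail (stail e))) _ df).
  by move=> [|[|i]] /=; apply: lin_var.
apply: (qf_scons (P := P) qP (g := fun e => g (stail e))).
by apply: (dfun_lin_comp (s := stail)) dg => i; apply: lin_var.
Qed.

Lemma dfun_stail g : dfun g -> dfun (fun e => g (stail e)).
Proof. by apply: (dfun_lin_comp (s := stail)) => i; apply: lin_var. Qed.

Lemma dfun_add f g : dfun f -> dfun g -> dfun (fun e => f e + g e).
Proof.
move=> df dg; apply: (dfun_scons (f := fun e => f (stail e) + e 0%N)) dg.
apply: (dfun_scons (f := fun e => e 0%N + e 1%N)); last exact: dfun_stail.
by apply/dfun_lin/lin_add; apply: lin_var.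
Qed.

Lemma dfun_scale c f : dfun f -> dfun (fun e => c * f e).
Proof.
by apply: (dfun_scons (f := fun e => c * e 0%N)); apply/dfun_lin/lin_scale/lin_var.
Qed.

Lemma dfun_comp_lin f (s : env -> env) :
  (forall i, dfun (fun e => s e i)) -> lin f -> dfun (fun e => f (s e)).
Proof.
move=> ds; elim=> [c|i|g h _ dg _ dh|c g _ dg] //.
- exact/dfun_lin/lin_cst.
- exact: dfun_add.
- exact: dfun_scale.
Qed.

(** Although [s] may change infinitely many variables, an atom tests a single linear form, whose
    composite with [s] is definable; substituting that one value suffices. *)
Lemma qf_comp P (s : env -> env) :
  (forall i, dfun (fun e => s e i)) -> qf P -> qf (fun e => P (s e)).
Proof.
move=> ds; elim=> [f lf|d f d0 lf|Q _ IH|Q Q' _ IH _ IH'].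
- apply: (qf_scons (P := fun e => 0 < e 0%N)); first exact/qf_pos/lin_var.
  exact: dfun_comp_lin.
- apply: (qf_scons (P := fun e => exists q, d * q = e 0%N)).
    exact/qf_dvd/lin_var.
  exact: dfun_comp_lin.
- exact: qf_not.
- exact: qf_and.
Qed.

Lemma dfun_comp f (s : env -> env) :
  (forall i, dfun (fun e => s e i)) -> dfun f -> dfun (fun e => f (s e)).
Proof.
move=> ds df; apply: (@qf_comp _ (fun e => e 0%N .: s (stail e)) _ df) => -[|i] /=.
  exact/dfun_lin/lin_var.
exact: (dfun_stail (ds i)).
Qed.

Lemma qf_le f g : dfun f -> dfun g -> qf (fun e => f e <= g e).
Proof.
move=> df dg.
apply: (@qf_ext (fun e => ~ 0 < f e + -1 * g e)); first by move=> e; lia.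
apply/qf_not/(qf_scons (P := fun e => 0 < e 0%N)); first exact/qf_pos/lin_var.
exact/dfun_add/dfun_scale.
Qed.

Lemma qf_eq f g : dfun f -> dfun g -> qf (fun e => f e = g e).
Proof.
move=> df dg; apply: qf_ext (qf_and (qf_le df dg) (qf_le dg df)) => e.
by split=> [[]|]; lia.
Qed.

Lemma dfun_if P f g : qf P -> dfun f -> dfun g ->
  dfun (fun e => if `[< P e >] then f e else g e).
Proof.
move=> qP df dg.
have qP' : qf (fun e => P (stail e)) by apply: qf_lin_comp qP => i; apply: lin_var.
apply: qf_ext (qf_or (qf_and qP' df) (qf_and (qf_not qP') dg)) => e.
by case: asboolP => ?; tauto.
Qed.

(** By uniqueness the graph of any choice function is [R] itself, hence definable. *)
Lemma dfun_unique_choice (R : int -> env -> Prop) :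
  qf (fun e => R (e 0%N) (stail e)) ->
  (forall e, exists z, R z e) -> (forall z z' e, R z e -> R z' e -> z = z') ->
  exists2 g, dfun g & forall e, R (g e) e.
Proof.
move=> qR exR inj; have [g Rg] := choice exR; exists g => //.
apply: qf_ext qR => e; split=> [Re|->]; last exact: Rg.
exact: inj Re (Rg _).
Qed.

(** * Definable functions are piecewise affine *)

(** Every value of [h] is a crossing of its graph: the predicate [z = h e] holds at [h e] and fails
    at [h e + M]. *)
Lemma dfun_branches h : dfun h ->
  exists B, lin_branches B /\ forall e, on_branch B (h e) e.
Proof.
move=> dh; have [M M0 /(_ 1 ltr01)] := qf_crossings dh.
rewrite mul1r => -[B [lB hB]]; exists B; split=> // e; apply: hB => /=.
by move=> [/(_ erefl) /eqP]; rewrite -subr_eq0 addrC addKr gt_eqF.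
Qed.

(* On each of the finitely many branches c h = g the function h is affine in
   its first variable, so a nonzero second difference with a step M that is
   compatible with the period requires a change of branch. *)
Lemma dfun_second_difference h : dfun h ->
  for_multiples (fun M => thin (fun y e =>
    h (y .: e) + h ((y + M + M) .: e) <> 2 * h ((y + M) .: e))).
Proof.
move=> dh; have [B [lB hB]] := dfun_branches dh.
pose P (b : int * (env -> int)) e := b.1 * h e = b.2 e.
have hP b : b \in B -> for_multiples (crossing_period (P b)).
  move=> /lB[_ lb]; apply/qf_crossings/qf_eq; last exact: dfun_lin.
  exact: dfun_scale.
apply: for_multiples_sub (for_multiples_all hP) => M _ tM.
have t1 := thin_exists_in tM; apply: thin_sub (thin_or t1 (thin_shift M t1)).
move=> y e; apply: contra_notP => /not_orP[n1 n2].
have [b bB Eb] := hB (y .: e); have [c0 lb] := lB b bB.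
have E1 : P b ((y + M) .: e).
  by apply: contrapT => H; apply: n1; exists b => //; rewrite /P; tauto.
have E2 : P b ((y + M + M) .: e).
  by apply: contrapT => H; apply: n2; exists b => //; tauto.
have [d [g [lg Eg]]] := lin_decomp lb; apply: (mulfI c0).
by rewrite mulrDr E2 Eb mulrCA E1 !Eg; ring.
Qed.

(** * Lexicographic comparison of codes *)

Definition lexle (s t : seq int) : bool := ((s : seqlexi int) <= t)%O.

Lemma lexle_refl s : lexle s s.
Proof. exact: lexx. Qed.

Lemma lexle_anti s t : lexle s t -> lexle t s -> s = t.
Proof. by move=> st ts; apply: (@le_anti _ (seqlexi int)); apply/andP. Qed.

Lemma lexle_trans s t u : lexle s t -> lexle t u -> lexle s u.
Proof. exact: (@le_trans _ (seqlexi int)). Qed.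

Lemma lexle_cons x s y t :
  lexle (x :: s) (y :: t) <-> x < y \/ x = y /\ lexle s t.
Proof.
have -> : lexle (x :: s) (y :: t) = (x <= y) && ((y <= x) ==> lexle s t) by [].
case: ltgtP => [xy|xy|<-] /=; split=> //; try by [left|right|case=> // -[]].
by case=> [|[]]; rewrite ?xy // => E; move: xy; rewrite E ltxx.
Qed.

Lemma lexle_cat s s' t t' : size s = size s' -> lexle s s' ->
  (s = s' -> lexle t t') -> lexle (s ++ t) (s' ++ t').
Proof.
elim: s s' => [|x s IH] [|x' s'] //=; first by move=> _ _ /(_ erefl).
move=> [ss] /lexle_cons H tt; apply/lexle_cons.
case: H => [|[exx le]]; [by left|right; split=> //].
by apply: IH => // ess; apply: tt; rewrite exx ess.
Qed.

Definition code (hs : seq (env -> int)) (e : env) : seq int := [seq h e | h <- hs].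

Definition dfuns (hs : seq (env -> int)) : Prop := forall h, h \in hs -> dfun h.

Definition pull (s : env -> env) (hs : seq (env -> int)) : seq (env -> int) :=
  [seq (fun e => h (s e)) | h <- hs].

Lemma code_pull s hs e : code (pull s hs) e = code hs (s e).
Proof. by rewrite /code /pull -map_comp. Qed.

Lemma code_cat hs gs e : code (hs ++ gs) e = code hs e ++ code gs e.
Proof. exact: map_cat. Qed.

Lemma size_code hs e : size (code hs e) = size hs.
Proof. exact: size_map. Qed.

Lemma dfuns_pull s hs : (forall i, dfun (fun e => s e i)) -> dfuns hs -> dfuns (pull s hs).
Proof. by move=> ds dh _ /mapP[h /dh ? ->]; apply: dfun_comp. Qed.

Lemma dfuns_cons h hs : dfun h -> dfuns hs -> dfuns (h :: hs).
Proof. by move=> dh dhs g; rewrite in_cons => /orP[/eqP->|/dhs]. Qed.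

Lemma dfuns_cat hs gs : dfuns hs -> dfuns gs -> dfuns (hs ++ gs).
Proof. by move=> dh dg g; rewrite mem_cat => /orP[/dh|/dg]. Qed.

Lemma qf_lexle hs gs : dfuns hs -> dfuns gs ->
  qf (fun e => lexle (code hs e) (code gs e)).
Proof.
elim: hs gs => [|h hs IH] [|g gs] dh dg.
- exact: (qf_cst true).
- exact: (qf_cst true).
- exact: (qf_cst false).
have dh1 : dfun h by apply: dh; rewrite mem_head.
have dg1 : dfun g by apply: dg; rewrite mem_head.
have IH' : qf (fun e => lexle (code hs e) (code gs e)).
  by apply: IH => k ks; [apply: dh|apply: dg]; rewrite in_cons ks orbT.
have q1 := qf_and (qf_not (qf_le dg1 dh1)) (qf_le dh1 dg1).
have q2 := qf_and (qf_eq dh1 dg1) IH'.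
apply: qf_ext (qf_or q1 q2) => e; split.
  by move=> H; apply/lexle_cons; case: H => [[]|]; [left; lia|right].
by move=> /lexle_cons[?|]; [left; lia|right].
Qed.

Lemma qf_code_eq hs gs : dfuns hs -> dfuns gs -> qf (fun e => code hs e = code gs e).
Proof.
move=> dh dg; apply: qf_ext (qf_and (qf_lexle dh dg) (qf_lexle dg dh)) => e.
by split=> [[]|->]; [apply: lexle_anti|rewrite lexle_refl].
Qed.

(** * Strictly increasing codes of families *)

(** Only pairs comparable pointwise on [Y] are constrained; on them the two conclusions together
    express strict monotonicity of the code [fs]. *)
Definition faithful_on (Y : int -> Prop) (hs fs : seq (env -> int)) : Prop :=
  forall a b, (forall y, Y y -> lexle (code hs (y .: a)) (code hs (y .: b))) ->
    lexle (code fs a) (code fs b) /\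
    (code fs a = code fs b -> forall y, Y y -> code hs (y .: a) = code hs (y .: b)).

Lemma faithful_on_cat Y1 Y2 hs fs gs :
  faithful_on Y1 hs fs -> faithful_on Y2 hs gs ->
  faithful_on (fun y => Y1 y \/ Y2 y) hs (fs ++ gs).
Proof.
move=> h1 h2 a b H.
have [l1 e1] := h1 a b (fun y Yy => H y (or_introl Yy)).
have [l2 e2] := h2 a b (fun y Yy => H y (or_intror Yy)).
rewrite !code_cat; split; first by apply: lexle_cat; rewrite ?size_code.
move=> /eqP; rewrite eqseq_cat ?size_code // => /andP[/eqP/e1 H1 /eqP/e2 H2] y.
by case=> [/H1|/H2].
Qed.

Lemma faithful_on_image (Y : int -> Prop) (p : int -> int) hs fs :
  faithful_on Y (pull (fun e => p (e 0%N) .: stail e) hs) fs ->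
  faithful_on (fun y => exists2 x, Y x & y = p x) hs fs.
Proof.
move=> H a b le; have := H a b; setoid_rewrite code_pull => -[].
  by move=> y Yy; apply: le; exists y.
by move=> l e; split=> // E _ [x Yx ->]; apply: e.
Qed.

(** * Bends and run-length codes on a half-line *)

Definition shift (c : int) (e : env) : env := (e 0%N + c) .: stail e.

(** The value at [y + 2] predicted by affine continuation from those at [y] and [y + 1]; a bend at
    [y] is thus a departure visible at [y + 2]. *)
Definition extrapolate (hs : seq (env -> int)) : seq (env -> int) :=
  [seq (fun e => 2 * h (shift 1 e) - h e) | h <- hs].

Definition bent (hs : seq (env -> int)) (e : env) : Prop :=
  code (pull (shift 2) hs) e <> code (extrapolate hs) e.

Lemma lin_shift c i : lin (fun e => shift c e i).
Proof.
case: i => [|i]; last exact: lin_var.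
by apply: lin_add; [apply: lin_var|apply: lin_cst].
Qed.

Lemma dfuns_shift c hs : dfuns hs -> dfuns (pull (shift c) hs).
Proof. by apply: dfuns_pull => i; apply/dfun_lin/lin_shift. Qed.

Lemma dfuns_extrapolate hs : dfuns hs -> dfuns (extrapolate hs).
Proof.
move=> dh _ /mapP[h /dh dh' ->].
apply: (@dfun_ext (fun e => 2 * h (shift 1 e) + -1 * h e)) => [e|]; first by ring.
apply: dfun_add; apply: dfun_scale => //.
by apply: dfun_comp dh' => i; apply/dfun_lin/lin_shift.
Qed.

Lemma qf_bent hs : dfuns hs -> qf (bent hs).
Proof.
move=> dh; apply/qf_not/qf_code_eq; first exact: dfuns_shift.
exact: dfuns_extrapolate.
Qed.

Lemma extrapolate_eq hs y a b :
  code hs (y .: a) = code hs (y .: b) ->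
  code hs ((y + 1) .: a) = code hs ((y + 1) .: b) ->
  code (extrapolate hs) (y .: a) = code (extrapolate hs) (y .: b).
Proof.
rewrite /code /extrapolate -!map_comp => /eq_in_map e0 /eq_in_map e1.
by apply/eq_in_map => h hhs /=; rewrite e0 // [h _]e1.
Qed.

(** Without bends both sequences follow the same affine recurrence of order two, so the two common
    initial values propagate. The last prediction, made at [n - 1], reaches [n + 1]. *)
Lemma unbent_agree hs a b n :
  code hs (0 .: a) = code hs (0 .: b) -> code hs (1 .: a) = code hs (1 .: b) ->
  (forall y, 0 <= y < n -> ~ bent hs (y .: a) /\ ~ bent hs (y .: b)) ->
  forall y, 0 <= y <= n + 1 -> code hs (y .: a) = code hs (y .: b).
Proof.
move=> e0 e1 nb.
have H (m : nat) : m%:Z <= n \/ m = 0%N -> code hs (m%:Z .: a) = code hs (m%:Z .: b) /\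
    code hs ((m%:Z + 1) .: a) = code hs ((m%:Z + 1) .: b).
  elim: m => [|m IH] mn; first by rewrite add0r.
  have [|E0 E1] := IH; first by lia.
  have -> : m.+1%:Z = m%:Z + 1 by lia.
  split=> //; have [|na nb'] := nb m%:Z; first by lia.
  move: na nb' => /contrapT + /contrapT; rewrite !code_pull /shift /= -addrA => -> ->.
  exact: extrapolate_eq.
move=> y /andP[y0 yn]; have [->//|y_0] := eqVneq y 0.
have [|_] := H `|(y - 1)%R|%N; first by lia.
by have -> : `|(y - 1)%R|%N%:Z + 1 = y by lia.
Qed.

(** The value -1 encodes the absence of bends, whose positions are nonnegative. *)
Definition first_bent (hs : seq (env -> int)) (z : int) (a : env) : Prop :=
  [/\ 0 <= z, bent hs (z .: a) & forall w, 0 <= w < z -> ~ bent hs (w .: a)] \/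
  z = -1 /\ forall w, 0 <= w -> ~ bent hs (w .: a).

Lemma dfun_first_bent hs : dfuns hs ->
  exists2 E, dfun E & forall a, first_bent hs (E a) a.
Proof.
move=> dh; have qb := qf_bent dh; apply: dfun_unique_choice.
(* In [Q1] variable 0 is an earlier bend and variable 1 the candidate for the first one. *)
- pose Q1 (e : env) := 0 <= e 0%N /\ e 0%N + 1 <= e 1%N /\ bent hs (e 0%N .: stail (stail e)).
  pose Q2 (e : env) := 0 <= e 0%N /\ bent hs (e 0%N .: stail (stail e)).
  have qb' : qf (fun e => bent hs (e 0%N .: stail (stail e))).
    by apply: qf_lin_comp qb => -[|i]; apply: lin_var.
  have d0 c : dfun (fun=> c) by apply/dfun_lin/lin_cst.
  have dv i : dfun (fun e => e i) by apply/dfun_lin/lin_var.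
  have q1 : qf Q1.
    apply/qf_and/qf_and/qb'; first exact: qf_le.
    by apply: qf_le => //; apply: dfun_add.
  have q2 : qf Q2 by apply/qf_and/qb'/qf_le.
  have := qf_or (qf_and (qf_le (d0 0) (dv 0%N)) (qf_and qb (qf_not (qf_ex q1))))
    (qf_and (qf_eq (dv 0%N) (d0 (-1))) (qf_not (qf_ex q2))).
  apply: qf_ext => e; rewrite /first_bent scons_eta /Q1 /Q2 /=; split.
    move=> [[e0 [be nx]]|[e0 nx]]; [left|right].
      split=> // w /andP[w0 we] bw; apply: nx; exists w; do !split=> //; lia.
    by split=> // w w0 bw; apply: nx; exists w.
  move=> [[e0 be nx]|[e0 nx]]; [left|right].
    do !split=> //; case=> w [w0 [we]]; apply: nx; lia.
  by do !split=> //; case=> w [w0]; apply: nx.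
- move=> a; have [[n bn]|none] := pselect (exists n : nat, bent hs (n%:Z .: a)).
    pose p (n : nat) := `[< bent hs (n%:Z .: a) >].
    have exp : exists n, p n by exists n; apply/asboolP.
    case: (ex_minnP exp) => m /asboolP bm min.
    exists m%:Z; left; split=> // w /andP[w0 wm] bw.
    have /min : p `|w|%N by apply/asboolP; rewrite gez0_abs.
    by lia.
  exists (-1); right; split=> // w w0 bw; apply: none; exists `|w|%N.
  by rewrite gez0_abs.
- move=> z z' a [[z0 bz nz]|[-> nz]] [[z0' bz' nz']|[-> nz']] //.
  + have [zz|zz|//] := ltgtP z z'.
      by case: (nz' z); rewrite ?z0 ?zz.
    by case: (nz z'); rewrite ?z0' ?zz.
  + by have := nz' _ z0.
  + by have := nz _ z0'.
Qed.

Definition rising (hs : seq (env -> int)) (e : env) : Prop :=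
  lexle (code (extrapolate hs) e) (code (pull (shift 2) hs) e).

(** The values -1, 0, 1 order a downward bend below no bend and no bend below an upward one. *)
Definition bend_sign (hs : seq (env -> int)) (E : env -> int) (a : env) : int :=
  if `[< E a = -1 >] then 0 else if `[< rising hs (E a .: a) >] then 1 else -1.

Definition bend_rank (hs : seq (env -> int)) (E : env -> int) (a : env) : int :=
  if `[< E a = -1 >] then 0
  else if `[< rising hs (E a .: a) >] then -1 * E a else E a.

Lemma dfuns_bend hs E : dfuns hs -> dfun E -> dfuns [:: bend_sign hs E; bend_rank hs E].
Proof.
move=> dh dE.
have dc c : dfun (fun=> c) by apply/dfun_lin/lin_cst.
have q1 : qf (fun a => E a = -1) by apply: qf_eq.
have q2 : qf (fun a => rising hs (E a .: a)).
  apply: (qf_scons (P := rising hs)) dE.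
  by apply: qf_lexle; [apply: dfuns_extrapolate|apply: dfuns_shift].
apply/dfuns_cons/dfuns_cons => //; first exact/dfun_if/dfun_if.
by apply/dfun_if/dfun_if => //; apply: dfun_scale.
Qed.

(* Before the first bend of either of two pointwise comparable sequences with
   the same two initial values the sequences agree, so the direction of that
   bend decides the comparison; among upward bends the earlier is the larger,
   among downward bends the earlier is the smaller. *)
Lemma bend_le hs E a b : (forall e, first_bent hs (E e) e) ->
  (forall y, 0 <= y -> lexle (code hs (y .: a)) (code hs (y .: b))) ->
  code hs (0 .: a) = code hs (0 .: b) -> code hs (1 .: a) = code hs (1 .: b) ->
  [\/ bend_sign hs E a < bend_sign hs E b,
      bend_sign hs E a = bend_sign hs E b /\ bend_rank hs E a < bend_rank hs E b |
      [/\ bend_sign hs E a = bend_sign hs E b, bend_rank hs E a = bend_rank hs E b,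
          E a = E b & forall y, 0 <= y <= E a -> code hs (y .: a) = code hs (y .: b)]].
Proof.
move=> hE le e0 e1.
have key n : 0 <= n ->
    (forall y, 0 <= y < n -> ~ bent hs (y .: a) /\ ~ bent hs (y .: b)) ->
    [/\ code (extrapolate hs) (n .: a) = code (extrapolate hs) (n .: b),
        lexle (code (pull (shift 2) hs) (n .: a)) (code (pull (shift 2) hs) (n .: b)) &
        forall y, 0 <= y <= n -> code hs (y .: a) = code hs (y .: b)].
  move=> n0 nb; have agree := unbent_agree e0 e1 nb; split.
  - by apply: extrapolate_eq; apply: agree; lia.
  - by rewrite !code_pull; apply: le => /=; lia.
  - by move=> y ?; apply: agree; lia.
(* If [a] does not bend at [n], it realises the common prediction, and [b] lies on or above [a]. *)
have up n : 0 <= n ->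
    (forall y, 0 <= y < n -> ~ bent hs (y .: a) /\ ~ bent hs (y .: b)) ->
    ~ bent hs (n .: a) -> rising hs (n .: b).
  by move=> n0 nb /contrapT ua; have [E1 E2 _] := key n n0 nb; rewrite /rising -E1 -ua.
(* Here [b] realises the common prediction and [a] lies on or below it; rising would force equality,
   against the bend. *)
have down n : 0 <= n ->
    (forall y, 0 <= y < n -> ~ bent hs (y .: a) /\ ~ bent hs (y .: b)) ->
    ~ bent hs (n .: b) -> bent hs (n .: a) -> ~ rising hs (n .: a).
  move=> n0 nb /contrapT ub ba ra; have [E1 E2 _] := key n n0 nb; apply: ba.
  by apply: lexle_anti ra; rewrite E1 -ub.
have rise n : 0 <= n ->
    (forall y, 0 <= y < n -> ~ bent hs (y .: a) /\ ~ bent hs (y .: b)) ->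
    rising hs (n .: a) -> rising hs (n .: b).
  by move=> n0 nb; have [+ + _] := key n n0 nb; rewrite /rising => -> h2 h1; apply: lexle_trans h1 h2.
rewrite /bend_sign /bend_rank; move: (hE a) (hE b).
set n := E a; set m := E b => -[[n0 bn nn]|[n_ nn]] [[m0 bm nm]|[m_ nm]].
- have [n_1 m_1] : n <> -1 /\ m <> -1 by lia.
  rewrite !(asboolF n_1) !(asboolF m_1).
  case: (ltgtP n m) => [nm'|nm'|nm'].
  + have nb y : 0 <= y < n -> ~ bent hs (y .: a) /\ ~ bent hs (y .: b).
      by move=> ?; split; [apply: nn|apply: nm]; lia.
    have ra : ~ rising hs (n .: a) by apply: down => //; apply: nm; lia.
    rewrite !(asboolF ra); case: asboolP => _; first by constructor 1.
    by constructor 2.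
  + have nb y : 0 <= y < m -> ~ bent hs (y .: a) /\ ~ bent hs (y .: b).
      by move=> ?; split; [apply: nn|apply: nm]; lia.
    have rb : rising hs (m .: b) by apply: up => //; apply: nn; lia.
    rewrite !(asboolT rb); case: asboolP => _; last by constructor 1.
    by constructor 2; split=> //; lia.
  + have nb y : 0 <= y < n -> ~ bent hs (y .: a) /\ ~ bent hs (y .: b).
      by move=> ?; split; [apply: nn|apply: nm]; lia.
    have [_ _ agree] := key n n0 nb; have := rise n n0 nb; rewrite -nm'.
    case: asboolP => ra; case: asboolP => rb h; try by [constructor 1|constructor 3].
    by case: rb; apply: h.
- have n_1 : n <> -1 by lia.
  have ra : ~ rising hs (n .: a).
    apply: down => //; last by apply: nm.
    by move=> y /[dup] ? /andP[y0 _]; split; [apply: nn|apply: nm].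
  by rewrite !(asboolF n_1) !(asboolF ra) !(asboolT m_); constructor 1.
- have m_1 : m <> -1 by lia.
  have rb : rising hs (m .: b).
    apply: up => //; last by apply: nn.
    by move=> y /[dup] ? /andP[y0 _]; split; [apply: nn|apply: nm].
  by rewrite !(asboolF m_1) !(asboolT rb) !(asboolT n_); constructor 1.
- rewrite !(asboolT n_) !(asboolT m_); constructor 3; split=> //.
    by rewrite n_ m_.
  by move=> y; rewrite n_; lia.
Qed.

(* A sequence with at most k bends is coded by its first two values, then the
   direction and the signed position of the first bend, then the code of the rest. *)
Lemma run_length_code k hs : dfuns hs ->
  (forall a (s : seq int), uniq s -> (forall y, y \in s -> 0 <= y /\ bent hs (y .: a)) ->
    (size s <= k)%N) ->
  exists2 fs, dfuns fs & faithful_on (fun y => 0 <= y) hs fs.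
Proof.
elim: k hs => [|k IH] hs dh hk.
  have nb a y : 0 <= y -> ~ bent hs (y .: a).
    move=> y0 b_y; suff: (1 <= 0)%N by [].
    by apply: (hk a [:: y]) => // z; rewrite inE => /eqP->.
  have d (c : int) : dfuns (pull (fun e => c .: e) hs).
    by apply: dfuns_pull dh => -[|i]; apply/dfun_lin; [apply: lin_cst|apply: lin_var].
  exists (pull (fun e => 0 .: e) hs ++ pull (fun e => 1 .: e) hs); first exact: dfuns_cat.
  move=> a b le; rewrite !code_cat !code_pull; split.
    apply: lexle_cat; rewrite ?size_code //; first exact: le.
    by move=> _; apply: le.
  move=> /eqP; rewrite eqseq_cat ?size_code // => /andP[/eqP e0 /eqP e1] y y0.
  apply: (unbent_agree (n := y) e0 e1); last lia.
  by move=> w /andP[w0 _]; split; apply: nb.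
have [E dE hE] := dfun_first_bent dh.
(* The tail starts just after the first bend; if there is none, [E] is -1 and the tail is the whole
   sequence. *)
pose tail (e : env) : env := (E (stail e) + 1 + e 0%N) .: stail e.
have dtail : dfuns (pull tail hs).
  apply: dfuns_pull dh => -[|i] /=; last exact/dfun_lin/lin_var.
  apply: dfun_add; last exact/dfun_lin/lin_var.
  by apply: dfun_add; [apply: dfun_stail|apply/dfun_lin/lin_cst].
have [fs dfs ffs] : exists2 fs, dfuns fs & faithful_on (fun y => 0 <= y) (pull tail hs) fs.
  apply: IH => // a s us hs_.
  have bent_tail y : bent (pull tail hs) (y .: a) -> bent hs ((E a + 1 + y) .: a).
    rewrite /bent /extrapolate /pull /code -!map_comp => H H'; apply: H.
    move: H' => /eq_in_map H'; apply/eq_in_map => h /H' /=.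
    by rewrite /tail /shift /= !addrA.
  have [[e0 be _]|[E_1 ne]] := hE a; last first.
    case: s us hs_ => // y s _ /(_ y); rewrite mem_head => /(_ isT)[y0].
    have /ne nb : 0 <= E a + 1 + y by lia.
    by move/bent_tail/nb.
  (* The bends of the tail, moved back to their original places, lie strictly after [E a], so
     adjoining [E a] gives one more bend of [hs]. *)
  rewrite -ltnS; have := hk a (E a :: [seq E a + 1 + y | y <- s]).
  rewrite /= size_map; apply.
    rewrite map_inj_uniq ?us ?andbT; last by move=> ? ?; apply: addrI.
    by apply/negP => /mapP[y /hs_[y0 _]]; lia.
  move=> y; rewrite inE => /orP[/eqP->//|/mapP[w /hs_[w0 /bent_tail bw] ->]].
  by split=> //; lia.
have d (c : int) : dfuns (pull (fun e => c .: e) hs).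
  by apply: dfuns_pull dh => -[|i]; apply/dfun_lin; [apply: lin_cst|apply: lin_var].
exists (pull (fun e => 0 .: e) hs ++ (pull (fun e => 1 .: e) hs ++
  ([:: bend_sign hs E; bend_rank hs E] ++ fs))).
  by do 3![apply: dfuns_cat => //]; apply: dfuns_bend.
(* Tails are comparable only when they start at the same place, which equality of sign and rank
   ensures through [bend_le]. *)
have tail_le a b : E a = E b ->
    (forall y, 0 <= y -> lexle (code hs (y .: a)) (code hs (y .: b))) ->
    forall y, 0 <= y ->
      lexle (code (pull tail hs) (y .: a)) (code (pull tail hs) (y .: b)).
  move=> eE le y y0; rewrite !code_pull /tail /= eE; apply: le.
  by have [[]|[]] := hE b; lia.
move=> a b le; rewrite !code_cat !code_pull; split.
  apply: lexle_cat; rewrite ?size_code //; first exact: le.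
  move=> e0; apply: lexle_cat; rewrite ?size_code //; first exact: le.
  move=> e1; apply/lexle_cons.
  have [?|[es lr]|[es er eE _]] := bend_le hE le e0 e1; first by left.
    by right; split=> //; apply/lexle_cons; left.
  right; split=> //; apply/lexle_cons; right; split=> //.
  by have [] := ffs a b (tail_le a b eE le).
move=> /eqP; rewrite !eqseq_cat ?size_code // => /and4P[/eqP e0 /eqP e1 /eqP [es er] /eqP ef].
have [|[_]|[_ _ eE agree]] := bend_le hE le e0 e1; rewrite ?es ?er ?ltxx //.
move=> y y0; have [yE|Ey] := leP y (E a); first by apply: agree; rewrite y0.
have [_ /(_ ef (y - E a - 1))] := ffs a b (tail_le a b eE le).
rewrite !code_pull /tail /= -eE.
have -> : E a + 1 + (y - E a - 1) = y by ring.
by apply; lia.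
Qed.

(** * From half-lines in residue classes to the whole line *)

Definition kinked (hs : seq (env -> int)) (M : int) (y : int) (e : env) : Prop :=
  exists2 h, h \in hs & h (y .: e) + h ((y + M + M) .: e) <> 2 * h ((y + M) .: e).

Lemma bent_kinked hs e :
  bent hs e -> kinked hs 1 (e 0%N) (stail e).
Proof.
rewrite -{1}[e]scons_eta; apply: contra_notP => nk.
rewrite /extrapolate /pull /code -!map_comp; apply/eq_in_map => h hhs /=.
have : h (e 0%N .: stail e) + h (e 0%N + 1 + 1 .: stail e) = 2 * h (e 0%N + 1 .: stail e).
  by apply: contrapT => H; apply: nk; exists h.
rewrite /shift /=; have -> : e 0%N + 2 = e 0%N + 1 + 1 by ring.
by move/(canRL (addKr _)) => H; rewrite [RHS]addrC; exact: H.
Qed.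

Lemma lin_affine (al be : int) i : lin (fun e => (al * e 0%N + be .: stail e) i).
Proof.
case: i => [|i]; last exact: lin_var.
by apply: lin_add; [apply/lin_scale/lin_var|apply: lin_cst].
Qed.

(** A bend along the progression is a kink with step [M], so thinness bounds the number of bends
    uniformly and [run_length_code] applies. *)
Lemma progression_code hs M al be : dfuns hs -> thin (kinked hs M) -> 0 < M ->
  al = M \/ al = - M ->
  exists2 fs, dfuns fs &
    faithful_on (fun y => exists2 x, 0 <= x & y = al * x + be) hs fs.
Proof.
move=> dh [C [lC hC]] M0 alM; set p := fun x : int => al * x + be.
have dp : dfuns (pull (fun e => p (e 0%N) .: stail e) hs).
  by apply: dfuns_pull dh => i; apply/dfun_lin/lin_affine.
suff [fs dfs ffs] : exists2 fs, dfuns fs &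
    faithful_on (fun y => 0 <= y) (pull (fun e => p (e 0%N) .: stail e) hs) fs.
  by exists fs => //; apply: faithful_on_image ffs.
apply: (@run_length_code (size C)) => // a s us hs_.
(* The least of the three consecutive points [p y], [p (y + 1)], [p (y + 2)], where [kinked] locates
   the kink; on a descending progression it is the last one. *)
pose q y := if al == M then p y else p y - 2 * M.
rewrite -(size_map q); apply: (@on_branch_size _ a) => //.
  rewrite map_inj_uniq // => y y'; rewrite /q /p.
  by case: eqP => _ ?; apply: (@mulfI _ al); lia.
move=> _ /mapP[y /hs_[_ /bent_kinked[_ /mapP[h hhs ->] /= H]] ->]; apply: hC.
exists h => //; rewrite /q; case: eqP => E; move: H; rewrite /p /=.
  rewrite -E; congr (_ + h (_ .: _) <> 2 * h (_ .: _)); ring.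
have {}E : al = - M by case: alM.
rewrite addrC; have -> : al * (y + 1 + 1) + be = al * y + be - 2 * M by rewrite E; ring.
have -> : al * (y + 1) + be = al * y + be - 2 * M + M by rewrite E; ring.
by have -> : al * y + be - 2 * M + M + M = al * y + be by ring.
Qed.

Lemma progressions_code hs M (ps : seq (int * int)) :
  dfuns hs -> thin (kinked hs M) -> 0 < M ->
  (forall p, p \in ps -> p.1 = M \/ p.1 = - M) ->
  exists2 fs, dfuns fs & faithful_on (fun y =>
    exists2 p, p \in ps & exists2 x, 0 <= x & y = p.1 * x + p.2) hs fs.
Proof.
move=> dh tk M0; elim: ps => [|p ps IH] hps.
  by exists [::] => // a b _; split=> // _ y [].
have [|fs dfs ffs] := IH.
  by move=> q qps; apply: hps; rewrite in_cons qps orbT.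
have [gs dgs fgs] := progression_code p.2 dh tk M0 (hps p (mem_head _ _)).
exists (gs ++ fs); first exact: dfuns_cat.
have := faithful_on_cat fgs ffs; congr faithful_on; apply/funext => y; apply/propext; split.
  move=> [H|[q qps H]]; first by exists p => //; rewrite mem_head.
  by exists q => //; rewrite in_cons qps orbT.
by move=> [q]; rewrite in_cons => /orP[/eqP-> H|qps H]; [left|right; exists q].
Qed.

Lemma line_code hs : dfuns hs ->
  exists2 fs, dfuns fs & faithful_on (fun=> True) hs fs.
Proof.
move=> dh.
have [M M0 /(_ 1 ltr01)] := for_multiples_all (fun h hhs => dfun_second_difference (dh h hhs)).
rewrite mul1r => /thin_exists_in tk.
(* One ascending and one descending half-line from each residue; the sign of the quotient by [M]
   tells which one contains [y]. *)
pose ps := [seq (M, r%:Z) | r <- iota 0 `|M|] ++ [seq (- M, r%:Z) | r <- iota 0 `|M|].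
have [|fs dfs ffs] := progressions_code (ps := ps) dh tk M0.
  by move=> p; rewrite mem_cat => /orP[] /mapP[r _ ->]; [left|right].
exists fs => //; move: ffs; congr faithful_on; apply/funext => y; apply/propext; split=> // _.
have r0 := modz_ge0 y (lt0r_neq0 M0); have rM := ltz_pmod y M0.
have rin : `|(y %% M)%Z|%N \in iota 0 `|M| by rewrite mem_iota; lia.
have Ey := divz_eq y M; have [q0|q0] := leP 0 (y %/ M)%Z.
  exists (M, `|(y %% M)%Z|%N%:Z).
    by rewrite mem_cat; apply/orP; left; apply: map_f.
  by exists (y %/ M)%Z => //=; rewrite gez0_abs // mulrC.
exists (- M, `|(y %% M)%Z|%N%:Z).
  by rewrite mem_cat; apply/orP; right; apply: map_f.
exists (- (y %/ M)%Z) => /=; first by lia.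
by rewrite gez0_abs // mulrNN mulrC.
Qed.

(** * Elimination of several arguments *)

Definition prepend (xs : seq int) (e : env) : env := foldr scons e xs.

Lemma grid_code m hs : dfuns hs ->
  exists2 fs, dfuns fs &
    forall a b,
      (forall xs, size xs = m -> lexle (code hs (prepend xs a)) (code hs (prepend xs b))) ->
      lexle (code fs a) (code fs b) /\
      (code fs a = code fs b ->
       forall xs, size xs = m -> code hs (prepend xs a) = code hs (prepend xs b)).
Proof.
elim: m hs => [|m IH] hs dh.
  exists hs => // a b le; split; first exact: (le [::]).
  by move=> E [|].
(* [gs] absorbs the first argument; the remaining ones are then arguments of the family [gs]. *)
have [gs dgs fgs] := line_code dh; have [fs dfs ffs] := IH gs dgs.
exists fs => // a b le.
have le1 xs : size xs = m ->
    forall y, True -> lexle (code hs (y .: prepend xs a)) (code hs (y .: prepend xs b)).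
  by move=> sxs y _; apply: (le (y :: xs)); rewrite /= sxs.
have [l e] := ffs a b (fun xs sxs => (fgs _ _ (le1 xs sxs)).1).
split=> // /e E [|y xs] //= [sxs].
by have [_ ->] := fgs _ _ (le1 xs sxs); rewrite ?E.
Qed.

(** * Translation between formulas and quantifier-free predicates *)

Definition tuple_of_env n (e : env) : n.-tuple int := [tuple e i | i < n].

Definition env_of_seq (s : seq int) : env := nth 0 s.

Lemma cons_tuple_of_env n z e :
  cons_tuple z (tuple_of_env n e) = tuple_of_env n.+1 (z .: e).
Proof.
apply: eq_from_tnth => i; rewrite tnth_mktuple.
case: (unliftP ord0 i) => [j ->|->]; last by rewrite tnth0.
by rewrite tnthS tnth_mktuple.
Qed.

Lemma cat_tuple_of_env m n e : tuple_of_env (m + n) e =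
  cat_tuple (tuple_of_env m e) (tuple_of_env n (fun i => e (m + i)%N)).
Proof.
apply: eq_from_tnth => i; rewrite tnth_mktuple; case: (split_ordP i) => j ->.
  by rewrite tnth_lshift tnth_mktuple.
by rewrite tnth_rshift tnth_mktuple.
Qed.

Lemma lin_eval n (t : term n) : lin (fun e => eval (tuple_of_env n e) t).
Proof.
elim: t => [i|t lt u lu] /=; last exact: lin_add.
by apply: lin_ext (lin_var i) => e; rewrite tnth_mktuple.
Qed.

Lemma qf_holds n (phi : formula n) : qf (fun e => holds (tuple_of_env n e) phi).
Proof.
elim: phi => {n} [n t u|n t u|n phi IH|n phi IH psi IH'|n phi IH] /=.
- by apply: qf_eq_lin; apply: lin_eval.
- apply: qf_ext (qf_pos (lin_sub (lin_eval u) (lin_eval t))) => e.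
  by rewrite subr_gt0.
- exact: qf_not.
- exact: qf_and.
- apply: qf_ext (qf_ex IH) => e.
  by split=> -[z Hz]; exists z; move: Hz; rewrite cons_tuple_of_env.
Qed.

Lemma definable_qf m (X : set (m.-tuple int)) :
  definable X -> qf (fun e => X (tuple_of_env m e)).
Proof.
move=> [k [p [phi ->]]].
(* The parameters enter as constant linear forms. *)
pose s (e : env) : env := fun i => if (i < m)%N then e i else nth 0 p (i - m)%N.
apply: (@qf_ext (fun e => holds (tuple_of_env (m + k) (s e)) phi)).
  move=> e; rewrite /= cat_tuple_of_env; suff -> : tuple_of_env m (s e) = tuple_of_env m e.
    suff -> : tuple_of_env k (fun i => s e (m + i)%N) = p by [].
    apply: eq_from_tnth => i; rewrite tnth_mktuple /s ltnNge leq_addr /= addKn.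
    by rewrite (tnth_nth 0).
  by apply: eq_from_tnth => i; rewrite !tnth_mktuple /s ltn_ord.
apply: qf_lin_comp (qf_holds phi) => i; rewrite /s; case: (i < m)%N.
  exact: lin_var.
exact: lin_cst.
Qed.

(** The multiple is by [k + 1], as there is no term for zero. *)
Fixpoint term_mul n (k : nat) (t : term n) : term n :=
  if k is k'.+1 then TAdd t (term_mul k' t) else t.

Lemma eval_term_mul n k e (t : term n) : eval e (term_mul k t) = k.+1%:Z * eval e t.
Proof. by elim: k => [|k IH] /=; rewrite ?IH ?mul1r // [k.+2%:Z]intS mulrDl mul1r. Qed.

(* The parameter 1 provides the constants, and splitting a linear form as a
   difference of two terms avoids the missing subtraction. *)
Lemma lin_terms f m : lin f -> exists t u : term (m + 1),
  forall x : m.-tuple int,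
    f (env_of_seq x) = eval (cat_tuple x [tuple 1]) t - eval (cat_tuple x [tuple 1]) u.
Proof.
pose one : term (m + 1) := TVar (rshift m ord0).
have one1 (x : m.-tuple int) : eval (cat_tuple x [tuple 1]) one = 1.
  by rewrite /= tnth_rshift.
elim=> [[k|k]|i|g h _ [t [u Eg]] _ [t' [u' Eh]]|[[|k]|k] g _ [t [u Eg]]].
- exists (term_mul k one), one => x; rewrite eval_term_mul one1; lia.
- exists one, (term_mul k.+1 one) => x; rewrite eval_term_mul one1 NegzE; lia.
- have [im|mi] := ltnP i m; last first.
    by exists one, one => x; rewrite subrr /env_of_seq nth_default ?size_tuple.
  exists (TAdd (TVar (lshift 1 (Ordinal im))) one), one => x.
  by rewrite /= addrK tnth_lshift (tnth_nth 0).
- by exists (TAdd t t'), (TAdd u u') => x; rewrite Eg Eh /=; ring.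
- by exists one, one => x; rewrite mul0r subrr.
- by exists (term_mul k t), (term_mul k u) => x; rewrite !eval_term_mul Eg mulrBr.
- exists (term_mul k u), (term_mul k t) => x; rewrite !eval_term_mul Eg NegzE; ring.
Qed.

Lemma qf_formula P m : qf P -> exists phi : formula (m + 1),
  forall x : m.-tuple int, holds (cat_tuple x [tuple 1]) phi <-> P (env_of_seq x).
Proof.
elim=> [f lf|d f d0 lf|Q _ [phi E]|Q Q' _ [phi E] _ [psi E']].
- have [t [u Ef]] := lin_terms m lf; exists (FLt u t) => x /=.
  by rewrite Ef subr_gt0.
(* Variable 0 is the quotient, to be bound by [FEx]; the vanishing of this form is an equation
   between two terms. *)
- have lg : lin (fun e => d * e 0%N - f (stail e)).
    apply: lin_sub; first exact/lin_scale/lin_var.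
    by apply: lin_comp lf => i; apply: lin_var.
  have [t [u Eg]] := lin_terms m.+1 lg; exists (FEx (FEq (t : term (m + 1).+1) u)) => x /=.
  have cons_env z : cons_tuple z (cat_tuple x [tuple 1]) =
      cat_tuple (cons_tuple z x) [tuple 1] :> (m + 1).+1.-tuple int by apply: val_inj.
  have Ex z : f (env_of_seq x) = f (stail (env_of_seq (cons_tuple z x))) by [].
  split=> -[z Hz]; exists z; move: (Eg (cons_tuple z x)); rewrite -Ex /=.
    by rewrite cons_env in Hz; rewrite Hz subrr => /eqP; rewrite subr_eq0 => /eqP.
  by rewrite Hz subrr cons_env => /esym/eqP; rewrite subr_eq0 => /eqP.
- by exists (FNot phi) => x /=; rewrite E.
- by exists (FAnd phi psi) => x /=; rewrite E E'.
Qed.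

Lemma qf_definable m (X : set (m.-tuple int)) P : qf P ->
  (forall x : m.-tuple int, X x <-> P (env_of_seq x)) -> definable X.
Proof.
move=> /(qf_formula m)[phi E] XP; exists 1%N, [tuple 1], phi.
by apply/funext => x; apply/propext; rewrite /= E.
Qed.

Lemma cat_tuple_inj m n (x x' : m.-tuple int) (y y' : n.-tuple int) :
  cat_tuple x y = cat_tuple x' y' -> (x, y) = (x', y').
Proof.
move=> /(congr1 val)/eqP; rewrite /= eqseq_cat ?size_tuple // => /andP[/eqP ex /eqP ey].
by congr pair; apply: val_inj.
Qed.

Lemma definable2_qf m n (X : set (m.-tuple int * n.-tuple int)) : definable2 X ->
  qf (fun e => X (tuple_of_env m e, tuple_of_env n (fun i => e (m + i)%N))).
Proof.
move=> /definable_qf; apply: qf_ext => e; rewrite cat_tuple_of_env; split.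
  by move=> [[x y] /= Xxy /cat_tuple_inj <-].
by move=> Xe; eexists; [exact: Xe|].
Qed.

(** * The embedding and its graph *)

Lemma lexltE n (x y : n.-tuple int) : lexlt x y <-> lexle x y /\ x <> y.
Proof.
have -> : lexlt x y = ((x : seqlexi int) < (y : seqlexi int))%O by [].
rewrite lt_neqAle -/(lexle x y); split.
  by move=> /andP[/eqP nxy le]; split=> // E; apply: nxy; rewrite E.
by move=> [le nxy]; apply/andP; split=> //; apply/eqP => /val_inj.
Qed.

Definition code_tuple fs (e : env) : (size fs).-tuple int :=
  map_tuple (fun h => h e) (in_tuple fs).

Lemma definable_code_graph m (D : set (m.-tuple int)) fs : definable D -> dfuns fs ->
  definable2 (graph_on D (fun a => code_tuple fs (env_of_seq a))).
Proof.
move=> /definable_qf qD dfs.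
(* In the joint tuple the entries from index [m] on are the values; they are reset to 0, the default
   of [env_of_seq], before the code is evaluated. *)
pose restrict (e : env) : env := fun i => if (i < m)%N then e i else 0.
pose coords := [seq (fun e : env => e (m + i)%N) | i <- iota 0 (size fs)].
have dr : dfuns (pull restrict fs).
  apply: dfuns_pull dfs => i; rewrite /restrict; apply: dfun_lin.
  by case: (i < m)%N; [apply: lin_var|apply: lin_cst].
have dc : dfuns coords by move=> _ /mapP[i _ ->]; apply/dfun_lin/lin_var.
apply: (qf_definable (qf_and qD (qf_code_eq dr dc))) => z.
rewrite code_pull.
have -> : code coords (env_of_seq z) = drop m z.
  rewrite /code /coords -map_comp; apply: (@eq_from_nth _ 0).
    by rewrite size_map size_iota size_drop size_tuple addKn.
  move=> i; rewrite size_map size_iota => isz.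
  by rewrite (nth_map 0%N) ?size_iota // nth_iota // nth_drop.
have -> : restrict (env_of_seq z) = env_of_seq (tuple_of_env m (env_of_seq z)).
  apply/funext => i; rewrite /restrict; case: ltnP => im.
    by rewrite {2}/env_of_seq (nth_mktuple _ _ (Ordinal im)).
  by rewrite {1}/env_of_seq nth_default // size_tuple.
have Et : tuple_of_env m (env_of_seq z) = take m z :> seq int.
  apply: (@eq_from_nth _ 0) => [|i]; rewrite size_tuple.
    by rewrite size_takel // size_tuple leq_addr.
  by move=> im; rewrite (nth_mktuple _ _ (Ordinal im)) nth_take.
split.
  move=> [_ [a Da <-] <-]; cbn [fst snd]; set y := code_tuple _ _.
  have -> : tuple_of_env m (env_of_seq (cat_tuple a y)) = a.
    apply: eq_from_tnth => i; rewrite tnth_mktuple /env_of_seq nth_cat size_tuple ltn_ord.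
    by rewrite (tnth_nth 0).
  by split=> //; rewrite drop_size_cat ?size_tuple.
move=> [Dz Ez]; exists (tuple_of_env m (env_of_seq z),
  code_tuple fs (env_of_seq (tuple_of_env m (env_of_seq z)))).
  by exists (tuple_of_env m (env_of_seq z)).
by apply: val_inj; rewrite -[RHS](cat_take_drop m) -Et -Ez.
Qed.

Lemma prepend_seq (xs s : seq int) :
  prepend xs (env_of_seq s) = env_of_seq (xs ++ s).
Proof.
elim: xs => [//|x xs IH]; rewrite /= -/(prepend xs _) IH.
by apply/funext => -[].
Qed.

Theorem theorem1p2 (m : nat) (hm : (0 < m)%N)
    (D : set (m.-tuple int)) (lt : set (m.-tuple int * m.-tuple int))
    (hL : definable_linear_order D lt) :
  exists (n : nat) (f : m.-tuple int -> n.-tuple int),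
    [/\ definable2 (graph_on D f),
        forall a b, D a -> D b -> (lt (a, b) <-> lexlt (f a) (f b))
      & forall a b, D a -> D b -> f a = f b -> a = b].
Proof.
case: hL => -[ltD irr trans total] dD dlt.
pose below (e : env) : Prop :=
  lt (tuple_of_env m e, tuple_of_env m (fun i => e (m + i)%N)).
pose chi (e : env) : int := if `[< below e >] then 1 else 0.
have dchi : dfuns [:: chi].
  apply: dfuns_cons => //; apply: dfun_if; first exact: definable2_qf.
    exact/dfun_lin/lin_cst.
  exact/dfun_lin/lin_cst.
have [fs dfs ffs] := grid_code m dchi.
have below_prepend (x a : m.-tuple int) :
    below (prepend x (env_of_seq a)) = lt (x, a).
  rewrite /below prepend_seq; congr (lt (_, _)).
    apply: eq_from_tnth => i; rewrite tnth_mktuple /env_of_seq nth_cat size_tuple ltn_ord.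
    by rewrite (tnth_nth 0).
  apply: eq_from_tnth => i; rewrite tnth_mktuple /env_of_seq nth_cat size_tuple.
  by rewrite ltnNge leq_addr /= addKn (tnth_nth 0).
pose f (a : m.-tuple int) := code_tuple fs (env_of_seq a).
have f_lt a b : D a -> D b -> lt (a, b) -> lexlt (f a) (f b).
  move=> Da Db ab; apply/lexltE.
  have [|le eq] := ffs (env_of_seq a) (env_of_seq b).
    (* By transitivity every predecessor of [a] is one of [b], so the characteristic functions are
       pointwise comparable. *)
    move=> xs sxs; apply/lexle_cons.
    have -> : xs = Tuple (introT eqP sxs) by [].
    rewrite /chi !below_prepend; case: asboolP => xa; case: asboolP => xb.
    - by right.
    - case: xb; apply: (trans _ a) => //.
      by have [] := ltD _ xa.
    - by left.
    - by right.
  (* Equal codes would give equal characteristic functions, but at the argument [a] they take the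
     values 0 for [a] and 1 for [b]. *)
  split=> // /(congr1 val) /eq /(_ a (size_tuple a)) [].
  rewrite /chi !below_prepend (asboolT ab) asboolF //; exact: irr.
have nlt a : ~ lexlt (f a) (f a) by move=> /lexltE[].
exists (size fs), f; split; first exact: definable_code_graph.
  move=> a b Da Db; split; first exact: f_lt.
  move=> fab; case: (total a b Da Db) => // [eab|ba].
    by case: (nlt b); rewrite -{1}eab.
  have /lexltE[le1 ne] := fab; have /lexltE[le2 _] := f_lt b a Db Da ba.
  by case: ne; apply/val_inj/lexle_anti.
move=> a b Da Db Ef; case: (total a b Da Db) => // [ab|ba].
  by case: (nlt b); rewrite -{1}Ef; apply: f_lt.
by case: (nlt b); rewrite -{2}Ef; apply: f_lt.
Qed.
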